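(* Let $w_1,w_2,w_3$ be any positive integers, let $n\ge 0$ be an integer and let $y_1,y_2,y_3\in\mathbb{Z}_p$. Then \begin{align*} &\sum_{k+l+m=n}\binom{n}{k,l,m}E_{k,q^{w_2w_3}}(w_1y_1)E_{l,q^{w_1w_3}}(w_2y_2)E_{m,q^{w_1w_2}}(w_3y_3)\,w_1^{l+m}w_2^{k+m}w_3^{k+l}\\ =&\sum_{k+l+m=n}\binom{n}{k,l,m}E_{k,q^{w_2w_3}}(w_1y_1)E_{l,q^{w_1w_2}}(w_3y_2)E_{m,q^{w_1w_3}}(w_2y_3)\,w_1^{l+m}w_3^{k+m}w_2^{k+l}\\ =&\sum_{k+l+m=n}\binom{n}{k,l,m}E_{k,q^{w_1w_3}}(w_2y_1)E_{l,q^{w_2w_3}}(w_1y_2)E_{m,q^{w_1w_2}}(w_3y_3)\,w_2^{l+m}w_1^{k+m}w_3^{k+l}\\ =&\sum_{k+l+m=n}\binom{n}{k,l,m}E_{k,q^{w_1w_3}}(w_2y_1)E_{l,q^{w_1w_2}}(w_3y_2)E_{m,q^{w_2w_3}}(w_1y_3)\,w_2^{l+m}w_3^{k+m}w_1^{k+l}\\ =&\sum_{k+l+m=n}\binom{n}{k,l,m}E_{k,q^{w_1w_2}}(w_3y_1)E_{l,q^{w_2w_3}}(w_1y_2)E_{m,q^{w_1w_3}}(w_2y_3)\,w_3^{l+m}w_1^{k+m}w_2^{k+l}\\ =&\sum_{k+l+m=n}\binom{n}{k,l,m}E_{k,q^{w_1w_2}}(w_3y_1)E_{l,q^{w_1w_3}}(w_2y_2)E_{m,q^{w_2w_3}}(w_1y_3)\,w_3^{l+m}w_2^{k+m}w_1^{k+l}.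 \end{align*}
   Context: Let $p$ be a fixed odd prime, $\mathbb{C}_p$ the completion of an algebraic closure of $\mathbb{Q}_p$ with absolute value normalized by $|p|_p=1/p$, and let $q\in\mathbb{C}_p$ be fixed with $|q-1|_p<p^{-1/(p-1)}$. For $r\in\mathbb{C}_p$ with $|r-1|_p<p^{-1/(p-1)}$ (in particular for $r=q^w$, $w$ a positive integer), the $r$-Euler polynomials $E_{n,r}(x)$ ($n\ge 0$) are the polynomials in $x$ defined by the generating function $$\frac{2}{re^{t}+1}e^{xt}=\sum_{n=0}^{\infty}E_{n,r}(x)\frac{t^n}{n!}.$$ Sums over $k+l+m=n$ run over all nonnegative integers $k,l,m$ with $k+l+m=n$, and $\binom{n}{k,l,m}=\frac{n!}{k!\,l!\,m!}$. *)

(* Defs.v *)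
From HB Require Import structures.
From mathcomp Require Import all_boot all_order all_algebra.
From mathcomp Require Import reals exp.

Set Implicit Arguments.
Unset Strict Implicit.
Unset Printing Implicit Defensive.

Import Order.TTheory GRing.Theory Num.Theory.

Local Open Scope ring_scope.

Section FormalPowerSeries.
Variable A : comUnitRingType.
Implicit Types f g : nat -> A.

Definition fps_const (a : A) : nat -> A := fun n => if n is 0%N then a else 0.

Definition fps_add f g : nat -> A := fun n => f n + g n.

Definition fps_mul f g : nat -> A := fun n => \sum_(i < n.+1) f i * g (n - i)%N.

(* e^(a t); meaningful when every n`!%:R is a unit of A. *)
Definition fps_exp (a : A) : nat -> A := fun n => a ^+ n / n`!%:R.

(* The first n coefficients of 1 / f, from the recursion
   g_n = f_0^-1 * ([n = 0] - \sum_(i < n) f_(n - i) * g_i). *)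
Fixpoint fps_inv_seq f (n : nat) : seq A :=
  if n is m.+1 then
    let s := fps_inv_seq f m in
    rcons s ((f 0%N)^-1 * ((m == 0%N)%:R - \sum_(i < m) f (m - i)%N * s`_i))
  else [::].

Definition fps_inv f : nat -> A := fun n => (fps_inv_seq f n.+1)`_n.

Lemma size_fps_inv_seq f n : size (fps_inv_seq f n) = n.
Proof. by elim: n => //= n IHn; rewrite size_rcons IHn. Qed.

Lemma nth_fps_inv_seq f n i : (i < n)%N -> (fps_inv_seq f n)`_i = fps_inv f i.
Proof.
elim: n => // n IHn; rewrite ltnS leq_eqVlt => /orP[/eqP -> //|lt_in].
by rewrite /= nth_rcons size_fps_inv_seq lt_in IHn.
Qed.

Lemma fps_invE f n :
  fps_inv f n =
    (f 0%N)^-1 * ((n == 0%N)%:R - \sum_(i < n) f (n - i)%N * fps_inv f i).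
Proof.
rewrite {1}/fps_inv /= nth_rcons size_fps_inv_seq ltnn eqxx.
by congr (_ * (_ - _)); apply: eq_bigr => i _; rewrite nth_fps_inv_seq.
Qed.

Lemma fps_mulVf f : f 0%N \is a GRing.unit ->
  fps_mul (fps_inv f) f =1 fps_const 1.
Proof.
move=> f0u n; rewrite /fps_mul big_ord_recr /= subnn fps_invE.
rewrite mulrAC mulVr // mul1r addrC -addrA [X in _ + X](_ : _ = 0) ?addr0.
  by case: n.
apply/eqP; rewrite addrC subr_eq0; apply/eqP.
by apply: eq_bigr => i _; rewrite mulrC.
Qed.

End FormalPowerSeries.

(* 'X is the variable x: the generating function 2 / (r e^t + 1) * e^(x t) is
   a power series in t over K[x], and E_{n,r}(x) is n! times its coefficient
   of t^n. The constant term r + 1 of the denominator is a unit of K[x] as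
   soon as r != -1. *)
Definition Euler_gf (K : fieldType) (r : K) : nat -> {poly K} :=
  fps_mul
    (fps_mul (fps_const 2)
       (fps_inv (fps_add (fps_mul (fps_const r%:P) (fps_exp 1)) (fps_const 1))))
    (fps_exp 'X).

Definition Euler_poly (K : fieldType) (n : nat) (r : K) : {poly K} :=
  n`!%:R * Euler_gf r n.

Record is_absval (R : realType) (K : fieldType) (v : K -> R) : Prop := {
  absval_ge0 : forall x, 0 <= v x;
  absval_eq0 : forall x, v x = 0 <-> x = 0;
  absvalM : forall x y, v (x * y) = v x * v y;
  absvalD : forall x y, v (x + y) <= v x + v y }.

Definition absval_cauchy (R : realType) (K : fieldType) (v : K -> R)
    (u : nat -> K) : Prop :=
  forall e : R, 0 < e ->
    exists N : nat, forall m n : nat, (N <= m)%N -> (N <= n)%N ->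
      v (u m - u n) < e.

Definition absval_converges (R : realType) (K : fieldType) (v : K -> R)
    (u : nat -> K) (l : K) : Prop :=
  forall e : R, 0 < e ->
    exists N : nat, forall n : nat, (N <= n)%N -> v (u n - l) < e.

Record is_completion (R : realType) (K L : fieldType) (vK : K -> R)
    (vL : L -> R) (i : {rmorphism K -> L}) : Prop := {
  completion_absval : is_absval vL;
  completion_isometry : forall x, vL (i x) = vK x;
  completion_dense : forall (y : L) (e : R), 0 < e ->
    exists x : K, vL (y - i x) < e;
  completion_complete : forall u : nat -> L,
    absval_cauchy vL u -> exists l : L, absval_converges vL u l }.

(* Normalized by |p|_p = 1/p. *)
Definition padic_abs (R : realType) (p : nat) (x : rat) : R :=
  if x == 0 then 0
  else p%:R ^+ logn p `|denq x|%N / p%:R ^+ logn p `|numq x|%N.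

(* A presentation of C_p: Q_p is the completion of the rationals for |.|_p,
   Qpbar an algebraic closure of Q_p with an absolute value extending the one
   of Q_p, and C_p the completion of Qpbar. These data determine C_p with its
   absolute value up to isometric isomorphism. *)
Record padic_complex (R : realType) (p : nat) := PadicComplex {
  Qp : fieldType;
  Qp_abs : Qp -> R;
  Qp_of_rat : {rmorphism rat -> Qp};
  Qp_completion : is_completion (padic_abs R p) Qp_abs Qp_of_rat;
  Qpbar : closedFieldType;
  Qpbar_abs : Qpbar -> R;
  Qpbar_of_Qp : {rmorphism Qp -> Qpbar};
  Qpbar_algebraic : forall z : Qpbar, algebraicOver Qpbar_of_Qp z;
  Qpbar_absval : is_absval Qpbar_abs;
  Qpbar_extends : forall x : Qp, Qpbar_abs (Qpbar_of_Qp x) = Qp_abs x;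
  Cp : fieldType;
  Cp_abs : Cp -> R;
  Cp_of_Qpbar : {rmorphism Qpbar -> Cp};
  Cp_completion : is_completion Qpbar_abs Cp_abs Cp_of_Qpbar }.

Arguments Cp_abs {R p} _ _.

(* Z_p, the closed unit ball of Q_p, as a subset of C_p. *)
Definition in_Zp (R : realType) (p : nat) (D : padic_complex R p)
    (y : Cp D) : Prop :=
  exists2 a : Qp D, Qp_abs a <= 1 & y = Cp_of_Qpbar D (Qpbar_of_Qp D a).

Definition trinomial (n k l m : nat) : nat := (n`! %/ (k`! * l`! * m`!))%N.

Definition sum3 (K : fieldType) (n : nat) (F : nat -> nat -> nat -> K) : K :=
  \sum_(k < n.+1) \sum_(l < n.+1) \sum_(m < n.+1 | (k + l + m == n)%N) F k l m.

(* Main.v *)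
(** Put w = w1 w2 w3. In the generating function of the first sum, the factor
    with index k contributes 2 / (q^(w2 w3) e^(w2 w3 t) + 1) * e^(w y1 t), and
    similarly for l and m. The product of the three factors is
    e^(w (y1 + y2 + y3) t) times a product that is symmetric in w1, w2, w3, so
    permuting the w's changes nothing. *)

Require Import Defs.
From HB Require Import structures.
From mathcomp Require Import all_boot all_order all_algebra.
From mathcomp Require Import boolp reals exp.
From mathcomp Require Import ring.

Set Implicit Arguments.
Unset Strict Implicit.
Unset Printing Implicit Defensive.

Import Order.TTheory GRing.Theory Num.Theory.

Local Open Scope ring_scope.

Section FormalPowerSeriesTheory.
Variable A : comUnitRingType.
Implicit Types (f g h : nat -> A) (a b s : A).

(** The substitution of [s * t] for the variable [t]. *)
Definition fps_scale s f : nat -> A := fun n => f n * s ^+ n.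

(** Coefficient [n] of a product involves no coefficient of higher index, so truncation loses
    nothing. This transfers ring identities from polynomials to series. *)
Lemma fps_mul_coef f g (N n : nat) : (n < N)%N ->
  fps_mul f g n = ((\poly_(i < N) f i) * (\poly_(i < N) g i))`_n.
Proof.
move=> ltnN; rewrite coefM; apply: eq_bigr => i _; rewrite !coef_poly.
have le_in : (i <= n)%N by rewrite -ltnS.
by rewrite (leq_ltn_trans le_in ltnN) (leq_ltn_trans (leq_subr i n) ltnN).
Qed.

Lemma fps_mulC f g : fps_mul f g = fps_mul g f.
Proof. by apply/funext => n; rewrite !(@fps_mul_coef _ _ n.+1) // mulrC. Qed.

Lemma poly_fps_mul f g (N n : nat) : (n < N)%N ->
  (\poly_(i < N) fps_mul f g i)`_n = ((\poly_(i < N) f i) * (\poly_(i < N) g i))`_n.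
Proof. by move=> ltnN; rewrite coef_poly ltnN; exact: fps_mul_coef. Qed.

Lemma fps_mulA f g h : fps_mul f (fps_mul g h) = fps_mul (fps_mul f g) h.
Proof.
apply/funext => n; rewrite !(@fps_mul_coef _ _ n.+1) //.
set F := \poly_(i < n.+1) f i; set G := \poly_(i < n.+1) g i.
set H := \poly_(i < n.+1) h i.
(* The truncation of a product differs from the product of the truncations, but only in degrees
   above [n]. *)
transitivity ((F * (G * H))`_n).
  rewrite !coefM; apply: eq_bigr => i _; congr (_ * _).
  by rewrite poly_fps_mul // ltnS leq_subr.
rewrite mulrA !coefM; apply: eq_bigr => i _; congr (_ * _).
by rewrite poly_fps_mul.
Qed.

Lemma fps_mulCA f g h : fps_mul f (fps_mul g h) = fps_mul g (fps_mul f h).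
Proof. by rewrite !fps_mulA (fps_mulC f). Qed.

Lemma fps_scaleM s f g :
  fps_scale s (fps_mul f g) = fps_mul (fps_scale s f) (fps_scale s g).
Proof.
apply/funext => n; rewrite /fps_scale /fps_mul mulr_suml.
apply: eq_bigr => i _; have le_in : (i <= n)%N by rewrite -ltnS.
by rewrite -[in s ^+ n](subnKC le_in) exprD mulrACA.
Qed.

Lemma fps_scale_exp s a : fps_scale s (fps_exp a) = fps_exp (s * a).
Proof.
by apply/funext => n; rewrite /fps_scale /fps_exp exprMn_comm; [ring | exact: mulrC].
Qed.

(** The binomial theorem divided by [n!], using [n! = 'C(n, i) * i! * (n - i)!]. *)
Lemma fps_expD a b : (forall n, n`!%:R \is a @GRing.unit A) ->
  fps_mul (fps_exp a) (fps_exp b) = fps_exp (a + b).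
Proof.
move=> fact_unit; apply/funext => n; rewrite /fps_mul /fps_exp.
rewrite addrC exprDn mulr_suml; apply: eq_bigr => i _.
have le_in : (i <= n)%N by rewrite -ltnS.
apply: (mulIr (fact_unit n)); rewrite divrK //.
rewrite -[_ *+ 'C(n, i)]mulr_natr -(bin_fact le_in) !natrM.
transitivity (b ^+ (n - i) * a ^+ i * 'C(n, i)%:R * (i`!%:R / i`!%:R)
   * ((n - i)`!%:R / (n - i)`!%:R)); first by ring.
by rewrite !divrr // !mulr1.
Qed.

End FormalPowerSeriesTheory.

Section EulerGeneratingFunction.
Variable K : fieldType.
Implicit Types (r x s : K) (f g : nat -> K).

Lemma fps_mul_polyC f g :
  fps_mul (fun i => (f i)%:P) (fun i => (g i)%:P) = fun i => (fps_mul f g i)%:P.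
Proof.
apply/funext => n; rewrite /fps_mul rmorph_sum /=.
by apply: eq_bigr => i _; rewrite polyCM.
Qed.

Lemma fps_const_polyC (a : K) : fps_const a%:P = fun i => (fps_const a i)%:P.
Proof. by apply/funext => -[|n]; rewrite /fps_const. Qed.

Lemma fps_inv_polyC f : fps_inv (fun i => (f i)%:P) = fun i => (fps_inv f i)%:P.
Proof.
apply/funext => n; elim/ltn_ind: n => n IHn.
(* Inverses commute with the embedding of constants even at [f 0 = 0], both being 0 by
   convention. *)
rewrite !fps_invE polyCM polyCV polyCB rmorph_nat rmorph_sum /=.
congr (_ * (_ - _)); apply: eq_bigr => i _.
by rewrite polyCM IHn.
Qed.

(** The series [2 / (r e^t + 1)] over [K] itself: the factor of the generating function that is free
    of [x]. *)
Definition Euler_number_gf r : nat -> K :=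
  fps_mul (fps_const 2)
    (fps_inv (fps_add (fps_mul (fps_const r) (fps_exp 1)) (fps_const 1))).

Lemma Euler_gfE r :
  Euler_gf r = fps_mul (fun i => (Euler_number_gf r i)%:P) (fps_exp 'X).
Proof.
have exp1 : fps_exp 1 = fun i => (fps_exp (1 : K) i)%:P.
  by apply/funext => n; rewrite /fps_exp !expr1n !div1r -polyCV rmorph_nat.
rewrite /Euler_gf /Euler_number_gf -fps_mul_polyC -fps_inv_polyC.
congr (fps_mul (fps_mul _ (fps_inv _)) _).
  by rewrite -fps_const_polyC rmorph_nat.
apply/funext => n; rewrite /fps_add polyCD.
by rewrite -polyC1 !fps_const_polyC polyC1 exp1 fps_mul_polyC.
Qed.

Lemma horner_Euler_gf r x n :
  (Euler_gf r n).[x] = fps_mul (Euler_number_gf r) (fps_exp x) n.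
Proof.
rewrite Euler_gfE /fps_mul horner_sum; apply: eq_bigr => i _.
by rewrite /fps_exp -polyC_natr polyCV !hornerE.
Qed.

(** Replacing [t] by [s * t] in the generating function absorbs the power [s ^+ n] and turns
    [e^(x t)] into [e^(s x t)]. *)
Lemma horner_Euler_poly r x s n :
  (Euler_poly n r).[x] * s ^+ n =
  n`!%:R * fps_mul (fps_scale s (Euler_number_gf r)) (fps_exp (s * x)) n.
Proof.
rewrite /Euler_poly hornerM -polyC_natr hornerC horner_Euler_gf.
by rewrite -fps_scale_exp -fps_scaleM mulrA.
Qed.

(** For given [k] and [l], the condition [k + l + m = n] leaves only [m = n - k - l] if
    [l <= n - k], and no [m] otherwise. *)
Lemma sum3_mul (f g h : nat -> K) n :
  sum3 n (fun k l m => f k * (g l * h m)) = fps_mul f (fps_mul g h) n.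
Proof.
apply: eq_bigr => k _; rewrite mulr_sumr.
have lekn : (k <= n)%N by rewrite -ltnS.
rewrite (big_ord_widen n.+1 (fun l => f k * (g l * h (n - k - l)%N))) ?ltnS ?leq_subr //.
rewrite [RHS]big_mkcond; apply: eq_bigr => l _; rewrite ltnS.
case: leqP => [le_l|lt_l].
  have lt_m : (n - k - l < n.+1)%N by rewrite ltnS -subnDA leq_subr.
  rewrite (big_pred1 (Ordinal lt_m)) //= => m.
  by rewrite /= -val_eqE /= -subnDA -[RHS](eqn_add2l (k + l)) subnKC // -leq_subRL.
rewrite big1 // => m /eqP klm; move: lt_l.
by rewrite ltnNge leq_subRL // -[leqRHS]klm leq_addr.
Qed.

(** The integer division in [trinomial] is exact, with quotient ['C(n, k + l) * 'C(k + l, k)]. *)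
Lemma trinomial_fact n k l m : (k + l + m = n)%N ->
  (trinomial n k l m * (k`! * l`! * m`!) = n`!)%N.
Proof.
move=> klm; rewrite divnK //; apply/dvdnP.
exists ('C(n, k + l) * 'C(k + l, k))%N.
have := @bin_fact n (k + l); rewrite -klm leq_addr addKn => <- //.
have := @bin_fact (k + l) k; rewrite leq_addr addKn => <- //.
by rewrite !mulnA.
Qed.

(** All six sums of the theorem are instances of this one, with the [w]'s permuted and the [y]'s
    kept in place. *)
Definition Euler_sum (q : K) (w1 w2 w3 : nat) (y1 y2 y3 : K) (n : nat) : K :=
  sum3 n (fun k l m => (trinomial n k l m)%:R
    * (Euler_poly k (q ^+ (w2 * w3))).[w1%:R * y1]
    * (Euler_poly l (q ^+ (w1 * w3))).[w2%:R * y2]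
    * (Euler_poly m (q ^+ (w1 * w2))).[w3%:R * y3]
    * w1%:R ^+ (l + m) * w2%:R ^+ (k + m) * w3%:R ^+ (k + l)).

Hypothesis fact_unit : forall n, n`!%:R \is a @GRing.unit K.

Lemma Euler_sumE q w1 w2 w3 y1 y2 y3 n :
  let N u := fps_scale u%:R (Euler_number_gf (q ^+ u)) in
  Euler_sum q w1 w2 w3 y1 y2 y3 n =
  n`!%:R * fps_mul (N (w2 * w3)%N) (fps_mul (N (w1 * w3)%N)
    (fps_mul (N (w1 * w2)%N) (fps_exp ((w1 * w2 * w3)%:R * (y1 + y2 + y3))))) n.
Proof.
move=> N; set w := (w1 * w2 * w3)%:R.
pose G u y := fps_mul (N u) (fps_exp (w * y)).
transitivity (n`!%:R *
    fps_mul (G (w2 * w3)%N y1) (fps_mul (G (w1 * w3)%N y2) (G (w1 * w2)%N y3)) n).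
  rewrite -sum3_mul /sum3 mulr_sumr; apply: eq_bigr => k _.
  rewrite mulr_sumr; apply: eq_bigr => l _.
  rewrite mulr_sumr; apply: eq_bigr => m /eqP /trinomial_fact <-.
  (* Here [v] is both the exponent of [q] and the scaling factor, so the argument [u * y] becomes
     [v * u * y = w * y], with the same [w] in all three factors. *)
  have EG u v y j : (u * v)%:R = w ->
      (Euler_poly j (q ^+ v)).[u%:R * y] * v%:R ^+ j = j`!%:R * G v y j.
    by move=> uvw; rewrite horner_Euler_poly /G -uvw natrM mulrCA mulrA.
  rewrite !natrM; set T := (trinomial _ _ _ _)%:R.
  transitivity (T * (k`!%:R * G (w2 * w3)%N y1 k) * (l`!%:R * G (w1 * w3)%N y2 l)
      * (m`!%:R * G (w1 * w2)%N y3 m)); last by ring.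
  (* The powers of the [w]'s regroup as [(w2 w3)^k (w1 w3)^l (w1 w2)^m]. *)
  rewrite -(EG w1) ?mulnA // -(EG w2) ?[(w2 * _)%N]mulnCA ?mulnA //.
  rewrite -(EG w3) ?[(w3 * _)%N]mulnC // !natrM !exprMn !exprD; ring.
(* The three exponentials are moved to the right and merged into one. *)
congr (_ * _); rewrite /G -fps_mulA; congr (fps_mul _ _ n).
rewrite -fps_mulA fps_mulCA; congr fps_mul.
rewrite [X in fps_mul _ X]fps_mulCA fps_mulCA; congr fps_mul.
by rewrite !fps_expD // !mulrDr addrA.
Qed.

(** The swap exchanges the first two factors of [Euler_sumE] and fixes the others. *)
Lemma Euler_sum_swap12 q w1 w2 w3 y1 y2 y3 n :
  Euler_sum q w1 w2 w3 y1 y2 y3 n = Euler_sum q w2 w1 w3 y1 y2 y3 n.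
Proof. by rewrite !Euler_sumE [in LHS]fps_mulCA (mulnC w1 w2). Qed.

Lemma Euler_sum_swap23 q w1 w2 w3 y1 y2 y3 n :
  Euler_sum q w1 w2 w3 y1 y2 y3 n = Euler_sum q w1 w3 w2 y1 y2 y3 n.
Proof.
rewrite !Euler_sumE (mulnC w3 w2) (mulnAC w1 w3 w2); congr (_ * fps_mul _ _ n).
exact: fps_mulCA.
Qed.

End EulerGeneratingFunction.

(** The rationals embed in C_p through Q_p and its algebraic closure, so C_p has characteristic
    0. *)
Lemma padic_complex_fact_unit (R : realType) (p : nat) (D : padic_complex R p) n :
  n`!%:R \is a @GRing.unit (Cp D).
Proof.
rewrite -(rmorph_nat (Cp_of_Qpbar D)) -(rmorph_nat (Qpbar_of_Qp D)).
rewrite -(rmorph_nat (Qp_of_rat D)) unitfE !fmorph_eq0 pnatr_eq0 -lt0n.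
exact: fact_gt0.
Qed.

Theorem theorem4p1 (R : realType) (p : nat) (p_prime : prime p) (p_odd : odd p)
    (D : padic_complex R p) (q : Cp D)
    (hq : Cp_abs D (q - 1) < p%:R `^ (- (p.-1%:R)^-1))
    (w1 w2 w3 : nat) (hw1 : (0 < w1)%N) (hw2 : (0 < w2)%N) (hw3 : (0 < w3)%N)
    (n : nat) (y1 y2 y3 : Cp D)
    (hy1 : in_Zp y1) (hy2 : in_Zp y2) (hy3 : in_Zp y3) :
  let E (k : nat) (r x : Cp D) : Cp D := (Euler_poly k r).[x] in
  let S1 := sum3 n (fun k l m => (trinomial n k l m)%:R
    * E k (q ^+ (w2 * w3)) (w1%:R * y1)
    * E l (q ^+ (w1 * w3)) (w2%:R * y2)
    * E m (q ^+ (w1 * w2)) (w3%:R * y3)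
    * w1%:R ^+ (l + m) * w2%:R ^+ (k + m) * w3%:R ^+ (k + l)) in
  let S2 := sum3 n (fun k l m => (trinomial n k l m)%:R
    * E k (q ^+ (w2 * w3)) (w1%:R * y1)
    * E l (q ^+ (w1 * w2)) (w3%:R * y2)
    * E m (q ^+ (w1 * w3)) (w2%:R * y3)
    * w1%:R ^+ (l + m) * w3%:R ^+ (k + m) * w2%:R ^+ (k + l)) in
  let S3 := sum3 n (fun k l m => (trinomial n k l m)%:R
    * E k (q ^+ (w1 * w3)) (w2%:R * y1)
    * E l (q ^+ (w2 * w3)) (w1%:R * y2)
    * E m (q ^+ (w1 * w2)) (w3%:R * y3)
    * w2%:R ^+ (l + m) * w1%:R ^+ (k + m) * w3%:R ^+ (k + l)) in
  let S4 := sum3 n (fun k l m => (trinomial n k l m)%:R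
    * E k (q ^+ (w1 * w3)) (w2%:R * y1)
    * E l (q ^+ (w1 * w2)) (w3%:R * y2)
    * E m (q ^+ (w2 * w3)) (w1%:R * y3)
    * w2%:R ^+ (l + m) * w3%:R ^+ (k + m) * w1%:R ^+ (k + l)) in
  let S5 := sum3 n (fun k l m => (trinomial n k l m)%:R
    * E k (q ^+ (w1 * w2)) (w3%:R * y1)
    * E l (q ^+ (w2 * w3)) (w1%:R * y2)
    * E m (q ^+ (w1 * w3)) (w2%:R * y3)
    * w3%:R ^+ (l + m) * w1%:R ^+ (k + m) * w2%:R ^+ (k + l)) in
  let S6 := sum3 n (fun k l m => (trinomial n k l m)%:R
    * E k (q ^+ (w1 * w2)) (w3%:R * y1)
    * E l (q ^+ (w1 * w3)) (w2%:R * y2)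
    * E m (q ^+ (w2 * w3)) (w1%:R * y3)
    * w3%:R ^+ (l + m) * w2%:R ^+ (k + m) * w1%:R ^+ (k + l)) in
  [/\ S1 = S2, S2 = S3, S3 = S4, S4 = S5 & S5 = S6].
Proof.
move=> E S1 S2 S3 S4 S5 S6.
have fu := @padic_complex_fact_unit R p D.
have e1 : S1 = Euler_sum q w1 w2 w3 y1 y2 y3 n by [].
(* The sums match up to the order of the factors in the exponents of [q]. *)
have e2 : S2 = Euler_sum q w1 w3 w2 y1 y2 y3 n by rewrite /Euler_sum (mulnC w3 w2).
have e3 : S3 = Euler_sum q w2 w1 w3 y1 y2 y3 n by rewrite /Euler_sum (mulnC w2 w1).
have e4 : S4 = Euler_sum q w2 w3 w1 y1 y2 y3 n.
  by rewrite /Euler_sum (mulnC w3 w1) (mulnC w2 w1).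
have e5 : S5 = Euler_sum q w3 w1 w2 y1 y2 y3 n.
  by rewrite /Euler_sum (mulnC w3 w2) (mulnC w3 w1).
have e6 : S6 = Euler_sum q w3 w2 w1 y1 y2 y3 n.
  by rewrite /Euler_sum (mulnC w2 w1) (mulnC w3 w1) (mulnC w3 w2).
(* The two adjacent transpositions generate all permutations; they link the sums in the chain [S4],
   [S3], [S1], [S2], [S5], [S6]. *)
have e12 : S1 = S2 by rewrite e1 e2 (Euler_sum_swap23 fu).
have e13 : S1 = S3 by rewrite e1 e3 (Euler_sum_swap12 fu).
have e34 : S3 = S4 by rewrite e3 e4 (Euler_sum_swap23 fu).
have e25 : S2 = S5 by rewrite e2 e5 (Euler_sum_swap12 fu).
have e56 : S5 = S6 by rewrite e5 e6 (Euler_sum_swap23 fu).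
by split=> //; [rewrite -e12 | rewrite -e34 -e13 e12].
Qed.
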